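(* Let $A=\begin{pmatrix} a & b \\ c & 0 \end{pmatrix}\in M_2(\mathbb{Z})$ with $bc\neq 0$ and $\gcd(a,b,c)=1$, let $K=\mathbb{Q}(\sqrt{a^2+4bc})$ with ring of integers $\mathcal{O}_K$, let $u,v,w$ be nonzero integers with $\gcd(u,v,w)=1$, and let $i,j,k$ be positive integers. Consider the matrix equation $uX^i+vY^j=wZ^k$ with $X,Y,Z\in C(A)$, a solution being non-trivial if $\det(XYZ)\neq 0$, and the equation $ux^i+vy^j=wz^k$, a solution being non-trivial if $xyz\neq 0$. 1) If $a^2+4bc$ is the square of an integer, then the matrix equation has a non-trivial solution in $C(A)$ if and only if $ux^i+vy^j=wz^k$ has a non-trivial solution with $x,y,z\in\mathbb{Z}$. 2) If $a^2+4bc$ is not a square and $D$ is the unique square-free integer such that $a^2+4bc=m^2D$ for some positive integer $m$, then the matrix equation has a non-trivial solution in $C(A)$ if and only if $ux^i+vy^j=wz^k$ has a non-trivial solution $(x,y,z)$ with $x,y,z\in\mathcal{O}_K$ each of which can be written in the form $\frac{s+t\sqrt{D}}{2}$ with $s,t\in\mathbb{Z}$ and $m\mid t$.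
   Context: $C(A)=\{B\in M_2(\mathbb{Z}): AB=BA\}$. *)

(* Defs.v *)
From HB Require Import structures.
From mathcomp Require Export all_boot all_order all_algebra all_field.

Set Implicit Arguments.
Unset Strict Implicit.
Unset Printing Implicit Defensive.

Import Order.TTheory GRing.Theory Num.Theory.
Local Open Scope ring_scope.

Definition mx2 (a b c d : int) : 'M[int]_2 :=
  \matrix_(i < 2, j < 2)
    if i == 0 then (if j == 0 then a else b) else (if j == 0 then c else d).

Definition in_commutant (A B : 'M[int]_2) : Prop := A * B = B * A.

Definition squarefreez (D : int) : Prop :=
  forall n : int, (n ^+ 2 %| D)%Z -> `|n| = 1.

(* Q(sqrt d) inside the algebraic complex numbers, as the smallest subfield   *)
(* containing sqrt d; sqrtC is the square root of argument in [0, pi), and    *)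
(* the subfield does not depend on the choice of root.                        *)
Definition quad_field (d : int) (x : algC) : Prop :=
  forall F : {pred algC},
    divring_closed F -> sqrtC (d%:~R) \in F -> x \in F.

Definition ring_of_integers (K : algC -> Prop) (x : algC) : Prop :=
  K x /\ x \in Aint.

Definition half_form (D m : int) (x : algC) : Prop :=
  exists s t : int,
    x = (s%:~R + t%:~R * sqrtC (D%:~R)) / 2%:R /\ (m %| t)%Z.

Definition mx_solvable (A : 'M[int]_2) (u v w : int) (i j k : nat) : Prop :=
  exists X Y Z : 'M[int]_2,
    [/\ in_commutant A X, in_commutant A Y & in_commutant A Z] /\
    u *: X ^+ i + v *: Y ^+ j = w *: Z ^+ k /\
    \det (X * Y * Z) != 0.

Definition solvable_in (R : nzRingType) (S : R -> Prop)
    (u v w : int) (i j k : nat) : Prop :=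
  exists x y z : R,
    [/\ S x, S y & S z] /\
    u%:~R * x ^+ i + v%:~R * y ^+ j = w%:~R * z ^+ k /\
    x * y * z != 0.

(* Main.v *)
(** Because gcd(a,b,c) = 1, the commutant C(A) is Z[A].  If l is a root of
    t^2 = a t + bc, then (l, c) is an eigenvector shared by all of Z[A], and
    reading off eigenvalues is a ring morphism p + qA |-> p + ql which is
    nonzero on matrices of nonzero determinant.  When a^2 + 4bc is a square, l
    is an integer; otherwise the morphism is injective and its image is exactly
    the set of algebraic integers (s + t sqrt D)/2 with m | t. *)

From HB Require Import structures.
Require Import Defs.
From mathcomp Require Import all_boot all_order all_algebra all_field.
From mathcomp Require Import ring zify.
Import Order.TTheory GRing.Theory Num.Theory.
Local Open Scope ring_scope.

(** * The commutant of a 2 by 2 integer matrix *)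

Lemma mx2_ext (R : Type) (M N : 'M[R]_2) :
  M 0 0 = N 0 0 -> M 0 1 = N 0 1 -> M 1 0 = N 1 0 -> M 1 1 = N 1 1 -> M = N.
Proof.
have ord2 (n : 'I_2) : n = 0 \/ n = 1.
  by case: n => [[|[|//]] ?]; [left|right]; apply: val_inj.
by move=> *; apply/matrixP => r s; case: (ord2 r) => ->; case: (ord2 s) => ->.
Qed.

Lemma dvdz_sqr (m n : int) : (m ^+ 2 %| n ^+ 2)%Z = (m %| n)%Z.
Proof. by rewrite !dvdzE !abszX dvdn_pexp2r. Qed.

Lemma gcdz3_eq1_Bezout (a b c : int) : gcdz (gcdz a b) c = 1 ->
  exists x y z : int, x * a + y * b + z * c = 1.
Proof.
move=> h; have [x [y xy]] := Bezoutz a b; have [s [t st]] := Bezoutz (gcdz a b) c.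
by exists (s * x), (s * y), t; rewrite -h -st -xy; ring.
Qed.

Lemma commutant_scalarD (a b c d p q : int) :
  in_commutant (mx2 a b c d) (p%:M + q *: mx2 a b c d).
Proof.
rewrite /in_commutant mulrDr mulrDl -scalerAl -scalerAr; congr (_ + _).
exact: scalar_mxC.
Qed.

(** For [B] with rows [(p, q)] and [(r, s)], commutation says that [(p - s, q, r)] is proportional
    to [(a, b, c)]. Since the latter is primitive, the ratio is an integer [n], and
    [B = s + n A]. *)
Lemma commutant_spanned (a b c : int) (B : 'M[int]_2) :
  gcdz (gcdz a b) c = 1 -> in_commutant (mx2 a b c 0) B ->
  exists p q : int, B = p%:M + q *: mx2 a b c 0.
Proof.
move=> /gcdz3_eq1_Bezout [x [y [z xyz]]] /matrixP com.
have e00 := com 0 0; have e01 := com 0 1; have e10 := com 1 0.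
rewrite !mxE !big_ord_recl !big_ord0 !mxE /= in e00 e01 e10.
have -> : B = mx2 (B 0 0) (B 0 1) (B 1 0) (B 1 1) by apply: mx2_ext; rewrite !mxE.
have l0 : lift (0 : 'I_2) 0 = 1 by apply: val_inj.
rewrite !l0 in e00 e01 e10.
move: (B 0 0) (B 0 1) (B 1 0) (B 1 1) e00 e01 e10 => p q r s e00 e01 e10.
have f1 : b * r = c * q by lia.
have f2 : b * (p - s) = a * q by lia.
have f3 : c * (p - s) = a * r by lia.
have split3 t : t = x * (a * t) + y * (b * t) + z * (c * t).
  by rewrite -[LHS]mul1r -xyz; ring.
(* The Bezout combination that sends [(a, b, c)] to 1 sends a multiple of [(a, b, c)] to its ratio,
   which is how [n] is found without division. *)
set n := x * (p - s) + y * q + z * r.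
have hq : q = n * b by rewrite [LHS]split3 -f1 -f2 /n; ring.
have hr : r = n * c by rewrite [LHS]split3 f1 -f3 /n; ring.
have hp : p = s + n * a.
  by rewrite -[LHS](subrK s) [p - s]split3 f2 f3 /n; ring.
exists s, n.
by apply: mx2_ext; rewrite !mxE //= ?mulr1n ?mulr0n ?add0r ?mulr0 ?addr0.
Qed.

(** * Eigenvalues of integer matrices on a fixed vector *)

Section EvalEigenvector.

Variables (R : numDomainType) (v : 'cV[R]_2).

(** A relation rather than a function: it passes through sums, multiples and powers with no choice
    of eigenvalue, and [v != 0] makes the eigenvalue unique. *)
Definition eigen_at (M : 'M[int]_2) (x : R) :=
  map_mx intr M *m v = x *: v.

Lemma eigen_atD M N x y :
  eigen_at M x -> eigen_at N y -> eigen_at (M + N) (x + y).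
Proof. by rewrite /eigen_at => hM hN; rewrite map_mxD mulmxDl hM hN scalerDl. Qed.

Lemma eigen_atZ u M x : eigen_at M x -> eigen_at (u *: M) (u%:~R * x).
Proof. by rewrite /eigen_at => hM; rewrite map_mxZ -scalemxAl hM scalerA. Qed.

Lemma eigen_atC u : eigen_at u%:M u%:~R.
Proof. by rewrite /eigen_at map_scalar_mx mul_scalar_mx. Qed.

Lemma eigen_atX n M x : eigen_at M x -> eigen_at (M ^+ n) (x ^+ n).
Proof.
rewrite /eigen_at => hM; elim: n => [|n IHn].
  by rewrite !expr0 map_mx1 mul1mx scale1r.
by rewrite exprS -mulmxE map_mxM -mulmxA IHn -scalemxAr hM scalerA -exprSr.
Qed.

Hypothesis v_neq0 : v != 0.

Lemma eigen_at_inj M x y : eigen_at M x -> eigen_at M y -> x = y.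
Proof.
rewrite /eigen_at => -> /eqP; rewrite -subr_eq0 -scalerBl => xy.
apply/eqP; rewrite -subr_eq0; apply: contraNT v_neq0 => nz.
apply/eqP/matrixP => r s; move/eqP/matrixP/(_ r s)/eqP: xy.
by rewrite !mxE mulf_eq0 (negbTE nz) => /eqP.
Qed.

(** The adjugate turns [M] into the scalar matrix of its determinant, which then has both [\det M]
    and 0 as eigenvalue on [v]. *)
Lemma eigen_at0_det M : eigen_at M 0 -> \det M = 0.
Proof.
move=> M0; have: eigen_at (\adj M *m M) 0.
  by move: M0; rewrite /eigen_at map_mxM -mulmxA => ->; rewrite !scale0r mulmx0.
rewrite mul_adj_mx => /(eigen_at_inj _ _ _ (eigen_atC _))/eqP.
by rewrite intr_eq0 => /eqP.
Qed.

End EvalEigenvector.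

(** * Transfer of solutions between matrices and eigenvalues *)

Section Quadratic.

Variables (R : numDomainType) (a b c : int) (l : R).
Hypothesis c_neq0 : c != 0.
Hypothesis l_root : l ^+ 2 = a%:~R * l + (b * c)%:~R.

Let v : 'cV[R]_2 := \col_i (if i == 0 then l else c%:~R).

Lemma quad_vec_neq0 : v != 0.
Proof.
apply/eqP => /matrixP /(_ 1 0) /eqP; rewrite !mxE /=.
by rewrite intr_eq0 (negbTE c_neq0).
Qed.

Lemma eigen_at_span p q :
  eigen_at R v (p%:M + q *: mx2 a b c 0) (p%:~R + q%:~R * l).
Proof.
apply: eigen_atD; [exact: eigen_atC|apply: eigen_atZ].
apply/matrixP => r s; rewrite !mxE !big_ord_recl big_ord0 !mxE /=.
case: ifP => _; rewrite ?mulr0z ?mul0r ?addr0 1?mulrC //.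
(* Only the top coordinate is left: it reads [a l + b c = l ^ 2]. *)
by rewrite -expr2 l_root intrM mulrC.
Qed.

Lemma mx_solvable_eval (u w' w : int) (i j k : nat) (S : R -> Prop) :
  gcdz (gcdz a b) c = 1 ->
  (forall p q : int, S (p%:~R + q%:~R * l)) ->
  mx_solvable (mx2 a b c 0) u w' w i j k -> solvable_in S u w' w i j k.
Proof.
move=> habc SP [X [Y [Z [[cX cY cZ] [eqXYZ dXYZ]]]]].
have spec B : in_commutant (mx2 a b c 0) B -> \det B != 0 ->
    exists x, [/\ S x, eigen_at R v B x & x != 0].
  move=> cB dB; have [p [q eB]] := commutant_spanned _ _ _ _ habc cB.
  exists (p%:~R + q%:~R * l); rewrite {1}eB; split => //.
    exact: eigen_at_span.
  apply: contraNneq dB => x0; apply/eqP/(eigen_at0_det R v quad_vec_neq0).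
  by rewrite -x0 eB; apply: eigen_at_span.
move: dXYZ; rewrite -!mulmxE !det_mulmx !mulf_eq0 !negb_or -andbA.
case/and3P => /(spec _ cX) [x [Sx hx x0]] /(spec _ cY) [y [Sy hy y0]].
case/(spec _ cZ) => z [Sz hz z0]; exists x, y, z; split => //; split.
  apply: (eigen_at_inj R v quad_vec_neq0 (w *: Z ^+ k)).
    by rewrite -eqXYZ; apply: eigen_atD; apply/eigen_atZ/eigen_atX.
  exact/eigen_atZ/eigen_atX.
by rewrite !mulf_neq0.
Qed.

(** The lifted matrices satisfy the equation because the difference [M] of its two sides is again
    [p + q A], with eigenvalue [p + q l = 0], so [inj] forces [M = 0]. Non-triviality lifts by
    [dinj]. *)
Lemma mx_solvable_lift (u w' w : int) (i j k : nat) (S : R -> Prop) :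
  gcdz (gcdz a b) c = 1 ->
  (forall p q : int, p%:~R + q%:~R * l = 0 -> p = 0 /\ q = 0) ->
  (forall p q : int, \det (p%:M + q *: mx2 a b c 0) = 0 -> p = 0 /\ q = 0) ->
  (forall x, S x -> exists p q : int, x = p%:~R + q%:~R * l) ->
  solvable_in S u w' w i j k -> mx_solvable (mx2 a b c 0) u w' w i j k.
Proof.
move=> habc inj dinj SP [x [y [z [[Sx Sy Sz] [eqxyz]]]]].
have spec s : S s -> s != 0 -> exists B,
    [/\ in_commutant (mx2 a b c 0) B, \det B != 0 & eigen_at R v B s].
  move=> /SP [p [q ->]] s0; exists (p%:M + q *: mx2 a b c 0); split.
  - exact: commutant_scalarD.
  - by apply: contraNneq s0 => /dinj [-> ->]; rewrite mul0r addr0.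
  - exact: eigen_at_span.
rewrite !mulf_eq0 !negb_or -andbA.
case/and3P => /(spec _ Sx) [X [cX dX hX]] /(spec _ Sy) [Y [cY dY hY]].
case/(spec _ Sz) => Z [cZ dZ hZ]; exists X, Y, Z; split => //; split; last first.
  by rewrite -!mulmxE !det_mulmx !mulf_neq0.
apply/eqP; rewrite -subr_eq0; apply/eqP.
have comZ e n B : in_commutant (mx2 a b c 0) B ->
    GRing.comm (mx2 a b c 0) (e *: B ^+ n).
  by move=> cB; rewrite /GRing.comm -scalerAr -scalerAl (commrX n cB).
set M := _ - _.
have cM : in_commutant (mx2 a b c 0) M.
  by apply: commrB; [apply: commrD|]; apply: comZ.
have hM : eigen_at R v M 0.
  have -> : M = u *: X ^+ i + w' *: Y ^+ j + (- w) *: Z ^+ k by rewrite scaleNr.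
  have -> : (0 : R) = u%:~R * x ^+ i + w'%:~R * y ^+ j + (- w)%:~R * z ^+ k.
    by rewrite eqxyz rmorphN mulNr subrr.
  by do 2?apply: eigen_atD; apply/eigen_atZ/eigen_atX.
have [p [q eM]] := commutant_spanned _ _ _ _ habc cM.
have /inj [p0 q0] : p%:~R + q%:~R * l = 0.
  by apply: (eigen_at_inj R v quad_vec_neq0 M) => //; rewrite eM; apply: eigen_at_span.
by rewrite eM p0 q0 scale0r addr0 raddf0.
Qed.

End Quadratic.

Lemma mx_solvable_scalar (A : 'M[int]_2) (u v w : int) (i j k : nat) :
  solvable_in (fun _ : int => True) u v w i j k -> mx_solvable A u v w i j k.
Proof.
move=> [x [y [z [_ [eqxyz nz]]]]]; exists x%:M, y%:M, z%:M.
have com s : in_commutant A s%:M by apply: scalar_mxC.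
split => //; split; last by rewrite -!mulmxE -!scalar_mxM det_scalar expf_neq0.
rewrite -!rmorphXn /= -!mul_scalar_mx -!scalar_mxM -raddfD /=.
by rewrite -[u]intz -[v]intz -[w]intz eqxyz.
Qed.

(** * Integer squares, parity and roots of monic quadratics *)

Lemma sqr_eq_mul_nonsquare (d s q : int) :
  ~ (exists n : int, d = n ^+ 2) -> s ^+ 2 = q ^+ 2 * d -> q = 0.
Proof.
move=> nsq e; apply/eqP/negPn/negP => q0.
have /dvdzP [n en] : (q %| s)%Z by rewrite -dvdz_sqr e dvdz_mulr.
case: nsq; exists n; apply: (@mulfI _ (q ^+ 2)); first by rewrite expf_neq0.
by rewrite -e en; ring.
Qed.

Lemma det_span (a b c p q : int) :
  \det (p%:M + q *: mx2 a b c 0) = p ^+ 2 + p * q * a - q ^+ 2 * (b * c).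
Proof.
rewrite (expand_det_row _ 0) !big_ord_recl big_ord0 /cofactor !det_mx11 !mxE /=.
by rewrite ?mulr1n ?mulr0n /bump /=; ring.
Qed.

(** If [s - t] were odd, the difference of squares would be odd too. *)
Lemma subr_sqr_mul4 (s t e : int) : s ^+ 2 - t ^+ 2 = 4 * e ->
  exists n : int, s = t + 2 * n.
Proof.
move=> h; have [n [r [est r01]]] :
    exists n r : int, s - t = 2 * n + r /\ (r = 0 \/ r = 1).
  exists ((s - t) %/ 2)%Z, ((s - t) %% 2)%Z; lia.
have -> : s = t + 2 * n + r by lia.
case: r01 => r01; exists n; first by rewrite r01 addr0.
have es : s = t + 2 * n + 1 by lia.
have : 4 * (n ^+ 2 + n + n * t) + 2 * t + 1 = 4 * e by rewrite -h es; ring.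
lia.
Qed.

Lemma int_square_disc_root (a e n : int) : a ^+ 2 + 4 * e = n ^+ 2 ->
  exists l : int, l ^+ 2 = a * l + e.
Proof.
move=> h; have /subr_sqr_mul4 [l en] : n ^+ 2 - a ^+ 2 = 4 * e by rewrite -h; ring.
(* Since [n = a + 2 l], the witness is the usual root [(a + n) / 2]. *)
exists (a + l); apply: (@mulfI _ 4) => //.
have -> : 4 * (a * (a + l) + e) = 4 * (a * (a + l)) + (n ^+ 2 - a ^+ 2).
  by rewrite -h; ring.
by rewrite en; ring.
Qed.

Lemma Aint_quadratic_root (x : algC) (s n : int) :
  x ^+ 2 = s%:~R * x + n%:~R -> x \in Aint.
Proof.
move=> hx; pose p : {poly int} := 'X^2 - (s *: 'X + n%:P).
have sp : (size (s *: 'X + n%:P)%R < 3)%N.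
  rewrite (leq_ltn_trans (size_polyD _ _)) // gtn_max.
  rewrite (leq_ltn_trans (size_scale_leq _ _)) ?size_polyX //.
  by rewrite (leq_ltn_trans (size_polyC_leq1 _)).
apply: (@root_monic_Aint (map_poly intr p)).
- rewrite /root /p rmorphB rmorphD /= linearZ /= map_polyXn map_polyX map_polyC /=.
  by rewrite !hornerE hx subrr.
- apply: monic_map; rewrite /p monicE lead_coefDl ?size_polyN ?size_polyXn //.
  by rewrite lead_coefXn.
- by apply/polyOverP => r; rewrite coef_map /= intr_int.
Qed.

(** * The quadratic integers [p + q l] when the discriminant is [m ^ 2 * D] *)

Section QuadraticIntegers.

Variables (a b c D m : int).
Hypothesis disc : a ^+ 2 + 4 * b * c = m ^+ 2 * D.

Let d : algC := m%:~R * sqrtC D%:~R.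
Let l : algC := (a%:~R + d) / 2%:R.

Lemma sqr_disc_root : d ^+ 2 = (a ^+ 2 + 4 * b * c)%:~R.
Proof. by rewrite /d exprMn sqrtCK disc rmorphM rmorphXn. Qed.

Lemma quad_root : l ^+ 2 = a%:~R * l + (b * c)%:~R.
Proof.
have -> : l ^+ 2 = (a%:~R ^+ 2 + 2 * a%:~R * d + d ^+ 2) / 4 by rewrite /l; field.
by rewrite sqr_disc_root /l !rmorphE /=; field.
Qed.

Lemma span_quad_root p q :
  p%:~R + q%:~R * l = ((2 * p + q * a)%:~R + q%:~R * d) / 2%:R :> algC.
Proof. by rewrite /l !rmorphE /=; field. Qed.

Lemma span_quad_integer p q :
  ring_of_integers (quad_field (a ^+ 2 + 4 * b * c)) (p%:~R + q%:~R * l) /\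
  half_form D m (p%:~R + q%:~R * l).
Proof.
have lK : l \in Aint by apply: Aint_quadratic_root quad_root.
split; last first.
  exists (2 * p + q * a), (q * m); split; last exact: dvdz_mull.
  by rewrite span_quad_root rmorphM /= -mulrA.
split; last by apply: rpredD; [|apply: rpredM]; rewrite ?Aint_int.
move=> F F_div dF.
pose F' := GRing.isDivringClosed.Build algC F F_div.
pose FS : divringClosed algC := HB.pack F F'.
have dF' : d \in FS.
  (* [d] and the adjoined root have the same square, so they agree up to sign, which any subfield
     absorbs. *)
  have: d ^+ 2 == (sqrtC (a ^+ 2 + 4 * b * c)%:~R) ^+ 2.
    by rewrite sqr_disc_root sqrtCK.
  by rewrite eqf_sqr => /orP[]/eqP->; rewrite ?rpredN.
change (p%:~R + q%:~R * l \in FS).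
apply: rpredD; first exact: rpred_int.
apply: rpredM; first exact: rpred_int.
by apply: rpred_div; [apply: rpredD => //; exact: rpred_int|exact: rpred_nat].
Qed.

Lemma quad_integer_span (x : algC) :
  x \in Aint -> half_form D m x -> exists p q : int, x = p%:~R + q%:~R * l.
Proof.
move=> xA [s [t' [ex /dvdzP [t et]]]].
have {}ex : x = (s%:~R + t%:~R * d) / 2%:R.
  by rewrite ex et /d rmorphM /= -mulrA.
(* The conjugate of x is s - x, so integrality of x makes its norm an integer. *)
have eN : x * (s%:~R - x) = (s ^+ 2 - t ^+ 2 * (a ^+ 2 + 4 * b * c))%:~R / 4.
  have -> : x * (s%:~R - x) = (s%:~R ^+ 2 - t%:~R ^+ 2 * d ^+ 2) / 4.
    by rewrite ex; field.
  by rewrite sqr_disc_root -!rmorphXn -rmorphM -rmorphB.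
have: x * (s%:~R - x) \in Num.int.
  apply: Cint_rat_Aint; last first.
    by apply: rpredM => //; apply: rpredB; rewrite ?Aint_int.
  by rewrite eN; apply: rpred_div; [exact: rpred_int|exact: rpred_nat].
case/intrP => N; rewrite eN => eN'.
have {}eN' : s ^+ 2 - t ^+ 2 * (a ^+ 2 + 4 * b * c) = N * 4.
  by apply/eqP; rewrite -(eqr_int algC) rmorphM /= -eN' divfK ?pnatr_eq0.
(* Writing [x = p + t l] requires [p = (s - t a) / 2]; integrality of the norm [N] provides exactly
   this parity. *)
have /subr_sqr_mul4 [p es] :
    s ^+ 2 - (t * a) ^+ 2 = 4 * (N + t ^+ 2 * (b * c)).
  by rewrite mulrDr [4 * N]mulrC -eN'; ring.
by exists p, t; rewrite span_quad_root ex es [t * a + _]addrC.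
Qed.

Hypothesis nonsquare : ~ exists n : int, a ^+ 2 + 4 * b * c = n ^+ 2.

(** Four times the form is [(2 p + q a) ^ 2] minus [q ^ 2] times the discriminant. The form is both
    the determinant of [p + q A] and the norm of [p + q l], so it yields both injectivity conditions
    for lifting. *)
Lemma norm_span_eq0 (p q : int) :
  p ^+ 2 + p * q * a - q ^+ 2 * (b * c) = 0 -> p = 0 /\ q = 0.
Proof.
move=> h; have q0 : q = 0.
  apply: (sqr_eq_mul_nonsquare _ (2 * p + q * a) _ nonsquare).
  apply/eqP; rewrite -subr_eq0; apply/eqP.
  by rewrite -[RHS](mulr0 4) -h; ring.
move: h; rewrite q0 mulr0 mul0r expr2 !mul0r subr0 addr0 => /eqP.
by rewrite mulf_eq0 orbb => /eqP.
Qed.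

Lemma span_quad_root_eq0 (p q : int) : p%:~R + q%:~R * l = 0 -> p = 0 /\ q = 0.
Proof.
move=> h; apply: norm_span_eq0; apply/eqP; rewrite -(eqr_int algC).
(* The conjugate of [l] is [a - l], so the norm factors through [p + q l]. *)
have -> : (p ^+ 2 + p * q * a - q ^+ 2 * (b * c))%:~R =
    (p%:~R + q%:~R * l) * (p%:~R + q%:~R * (a%:~R - l)) :> algC.
  have -> : (p%:~R + q%:~R * l) * (p%:~R + q%:~R * (a%:~R - l)) =
    p%:~R ^+ 2 + p%:~R * q%:~R * a%:~R + q%:~R ^+ 2 * (a%:~R * l - l ^+ 2) by ring.
  by rewrite quad_root !rmorphE /=; ring.
by rewrite h mul0r.
Qed.

End QuadraticIntegers.

Theorem theorem3p3 (a b c u v w : int) (i j k : nat)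
  (hbc : b * c != 0) (habc : gcdz (gcdz a b) c = 1)
  (hu : u != 0) (hv : v != 0) (hw : w != 0)
  (huvw : gcdz (gcdz u v) w = 1)
  (hi : (0 < i)%N) (hj : (0 < j)%N) (hk : (0 < k)%N) :
  ((exists n : int, a ^+ 2 + 4 * b * c = n ^+ 2) ->
    (mx_solvable (mx2 a b c 0) u v w i j k <->
     solvable_in (fun _ : int => True) u v w i j k))
  /\
  (~ (exists n : int, a ^+ 2 + 4 * b * c = n ^+ 2) ->
    forall D m : int, squarefreez D -> 0 < m ->
    a ^+ 2 + 4 * b * c = m ^+ 2 * D ->
    (mx_solvable (mx2 a b c 0) u v w i j k <->
     solvable_in
       (fun x : algC =>
          ring_of_integers (quad_field (a ^+ 2 + 4 * b * c)) x /\
          half_form D m x)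
       u v w i j k)).
Proof.
have c_neq0 : c != 0 by apply: contraNneq hbc => ->; rewrite mulr0.
split=> [[n hn]|nsq D m _ _ disc].
  split; last exact: mx_solvable_scalar.
  (* The transported equality only reassociates [4 * b * c] as [4 * (b * c)]; evaluation then takes
     place in the integers themselves. *)
  have [l hl] := int_square_disc_root a (b * c) n (etrans (congr1 _ (mulrA _ _ _)) hn).
  by apply: (mx_solvable_eval _ a b c l c_neq0) => //; rewrite !intz.
have root := quad_root _ _ _ _ _ disc.
split; first exact: (mx_solvable_eval _ _ _ _ _ c_neq0 root) (span_quad_integer _ _ _ _ _ disc).
apply: (mx_solvable_lift _ _ _ _ _ c_neq0 root) => //.
- exact: span_quad_root_eq0 disc nsq.
- by move=> p q; rewrite det_span; exact: (norm_span_eq0 _ _ _ nsq).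
- by move=> x [[_ xA] hx]; apply: quad_integer_span disc _ xA hx.
Qed.
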